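(* Let $D$ be a non-empty, bounded, open interval in $\mathbb{R}$. Let $X=(X_t)_{t\in[0,1]}$ be a zero-mean Gaussian process in $\mathbb{R}$ with càdlàg paths starting at the origin and variance function $R_t$ under the probability measure $\mathbb{P}=\mathbb{P}_0$ such that $X_t$ is non-degenerate for all $t\in(0,1]$. Then for any $t\in(0,1]$, $$|D|-H^X_D(t)=\sqrt{\frac{2R_t}{\pi}}-\mathrm{Error}_H(t),$$ where $$0<\mathrm{Error}_H(t)\le\frac{2R_t^{3/2}}{|D|^2\sqrt{2\pi}}\,e^{-\frac{|D|^2}{2R_t}}.$$ Consequently, $$\lim_{t\downarrow0}\frac{|D|-H^X_D(t)}{\sqrt{R_t}}=\sqrt{\frac{2}{\pi}}.$$
   Context: A real-valued process is a Gaussian process if all its finite-dimensional distributions are (multivariate) Gaussian. The process $X$ is the coordinate process on the space $\mathbb{D}[0,1]$ of real-valued càdlàg functions on $[0,1]$, equipped with the Borel $\sigma$-algebra of the Skorokhod $J_1$ topology (equivalently, the $\sigma$-algebra generated by coordinate projections), under a probability measure $\mathbb{P}=\mathbb{P}_0$ with $\mathbb{P}(X_0=0)=1$. The variance function is $R_t=\mathbb{E}[X_t^2]$. Non-degenerate means $\mathbb{P}(X_t\ne0)>0$ (equivalently $R_t>0$). For $x\in D$, $\mathbb{P}_x(F):=\mathbb{P}(F-x)$ with $F-x=\{\omega:\omega(\cdot)+x\in F\}$; that is, $X$ under $\mathbb{P}_x$ has the law of $x+X$ under $\mathbb{P}$. The regular heat content is $H^X_D(t):=\int_D\mathbb{P}_x(X_t\in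 D)\,dx$, $t\in(0,1]$. $|D|$ is the length of $D$. *)

(* Defs.v *)
From HB Require Import structures.
From mathcomp Require Import all_boot all_order all_algebra.
From mathcomp Require Import all_classical all_reals all_analysis.

Set Implicit Arguments.
Unset Strict Implicit.
Unset Printing Implicit Defensive.
Import Order.TTheory GRing.Theory Num.Theory.
Import numFieldNormedType.Exports.

Local Open Scope classical_set_scope.
Local Open Scope ring_scope.

(* As a type, [I01 R] carries the topology induced by that of R. *)
Definition I01 (R : realType) : set R := `[0, 1].
Arguments I01 R : clear implicits.

Lemma I01_zero (R : realType) : 0 \in I01 R.
Proof. by rewrite inE /I01 /= in_itv /= lexx ler01. Qed.

Definition time0 (R : realType) : I01 R := SigSub (I01_zero R).
Arguments time0 R : clear implicits.

Section Filters.
Context {R : realType}.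
Implicit Types t : I01 R.

Definition from_right t : set_system (I01 R) :=
  within [set s : I01 R | val t < val s] (nbhs t).

Definition from_left t : set_system (I01 R) :=
  within [set s : I01 R | val s < val t] (nbhs t).

End Filters.

Definition cadlag (R : realType) (f : I01 R -> R) : Prop := forall t : I01 R,
  (val t < 1 -> f s @[s --> from_right t] --> f t) /\
  (0 < val t -> cvg (f s @[s --> from_left t])).

Record skorokhod (R : realType) : Type :=
  Path { path_fun :> I01 R -> R ; path_cadlag : cadlag path_fun }.
Arguments skorokhod R : clear implicits.

Lemma cadlag_cst (R : realType) (c : R) : cadlag (fun _ : I01 R => c).
Proof.
by move=> t; split=> _; [exact: cvg_cst|apply/cvg_ex; exists c; exact: cvg_cst].
Qed.

Lemma cadlag_addl (R : realType) (x : R) (f : I01 R -> R) :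
  cadlag f -> cadlag (fun t => x + f t).
Proof.
move=> cf t; have [fr fl] := cf t; split=> [t1|t0].
  by apply: cvgD; [exact: cvg_cst|exact: fr].
move/cvg_ex : (fl t0) => [l fl']; apply/cvg_ex; exists (x + l).
by apply: cvgD; [exact: cvg_cst|exact: fl'].
Qed.

HB.instance Definition _ (R : realType) := gen_eqMixin (skorokhod R).
HB.instance Definition _ (R : realType) := gen_choiceMixin (skorokhod R).
HB.instance Definition _ (R : realType) :=
  isPointed.Build (skorokhod R) (Path (cadlag_cst 0)).

Definition coordinate (R : realType) (t : I01 R) (w : skorokhod R) : R := w t.

Definition coordinate_events (R : realType) : set (set (skorokhod R)) :=
  \bigcup_(t in [set: I01 R])
    preimage_set_system [set: skorokhod R] (coordinate t) measurable.
Arguments coordinate_events R : clear implicits.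

(* The sigma-algebra generated by the coordinate projections is also the Borel
   sigma-algebra of the Skorokhod J1 topology. *)
HB.instance Definition _ (R : realType) :=
  Measurable.copy (skorokhod R) (g_sigma_algebraType (coordinate_events R)).

Definition translate (R : realType) (x : R) (w : skorokhod R) : skorokhod R :=
  Path (cadlag_addl x (@path_cadlag R w)).

(* The normal law with mean m and variance s ^+ 2. The degenerate case is
   separate because the library's [normal_prob m 0] is not a point mass. *)
Definition gaussian_law (R : realType) (m s : R) : set R -> \bar R :=
  if s == 0 then \d_m else normal_prob m s.

Section Processes.
Context {d : measure_display} {T : measurableType d} {R : realType}.
Variable P : probability T R.

(* Possibly degenerate multivariate Gaussian law: every linear combination of
   the components is Gaussian, a constant being a Gaussian of variance 0. *)
Definition gaussian_vector (n : nat) (Y : 'I_n -> T -> R) : Prop :=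
  forall a : 'I_n -> R, exists m s : R, forall B : set R, measurable B ->
    P [set w | B (\sum_(i < n) a i * Y i w)] = gaussian_law m s B.

Definition gaussian_process (X : I01 R -> T -> R) : Prop :=
  forall (n : nat) (t : 'I_n -> I01 R), gaussian_vector (fun i => X (t i)).

End Processes.

Section HeatContent.
Context {R : realType}.
Variable P : probability (skorokhod R) R.

Definition prob_from (x : R) : set (skorokhod R) -> \bar R :=
  pushforward P (translate x).

Definition variance_function (t : I01 R) : R :=
  fine ('E_P[fun w => (coordinate t w ^+ 2)%R])%E.

Definition len (D : set R) : R := fine (lebesgue_measure D).

Definition heat_content (D : set R) (t : I01 R) : R :=
  fine (\int[lebesgue_measure]_(x in D)
          prob_from x [set w | D (coordinate t w)])%E.

End HeatContent.

(* Main.v *)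
(** The law of [X t] is a centred normal law with standard deviation [s > 0].
    By Tonelli, with [L = |D|], [|D| - H(t) = E min(|X t|, L)
    = E |X t| - E (|X t| - L)^+].  The first term is [s sqrt(2/pi)]; the second,
    the error, is [2 int_L^oo (y - L) phi(y) dy], positive and estimated by
    [phi(y) <= phi(L) exp(- L (y - L) / s^2)].  For the limit, right continuity
    at time 0 and dominated convergence give [P(|X t| <= r) -> 1] for every
    [r > 0], whereas [P(|X t| <= r) <= r / s]; hence [s -> 0]. *)

Require Import Defs.
From HB Require Import structures.
From mathcomp Require Import all_boot all_order all_algebra.
From mathcomp Require Import all_classical all_reals all_analysis.
From mathcomp Require Import measurable_realfun ring lra.
Import Order.TTheory GRing.Theory Num.Theory.
Import numFieldNormedType.Exports.

Set Implicit Arguments.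
Unset Strict Implicit.
Unset Printing Implicit Defensive.

Local Open Scope classical_set_scope.
Local Open Scope ring_scope.

(** * Integrals against the normal density *)

(** Subtraction is delicate in [\bar R], so the heat-loss identities and the second moment are
    proved as sums of nonnegative integrals; real arithmetic resumes once every term is known to be
    finite. The shape of the error bound comes from a tangent line. Replacing the exponent of the
    density by its tangent at [L], of slope [- L / s ^+ 2], turns the tail into a gamma integral
    worth [(s ^+ 2 / L) ^+ 2]; the peak of the density brings a factor [1 / s], which leaves
    [s ^+ 3 / L ^+ 2], that is, the power 3/2 of the variance over the squared length. Continuity of
    the variance at time 0 is not a hypothesis, and pathwise convergence by itself controls no
    moment. Normality bridges the gap: the height of the density is inversely proportional to [s],
    so a variance bounded away from 0 would keep a fixed share of the mass outside a small ball. *)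

Section NormalDensity.
Context {R : realType}.
Implicit Types (m s y : R).
Local Notation mu := (@lebesgue_measure R).

Lemma normal_pdf_gt0 m s y : s != 0 -> 0 < normal_pdf m s y.
Proof.
move=> s0; rewrite (normal_pdfE m s0); apply: mulr_gt0; last exact: expR_gt0.
exact: normal_peak_gt0.
Qed.

(** The density depends on [s] only through its square. [gaussian_law] allows a negative parameter,
    which this makes positive. *)
Lemma normal_pdf_norm m s : normal_pdf m `|s| = normal_pdf m s.
Proof.
rewrite /normal_pdf normr_eq0; case: eqP => // _; apply/funext => y.
by rewrite /normal_peak /normal_fun real_normK ?num_real.
Qed.

Lemma normal_pdfN m s y : s != 0 -> normal_pdf m s (- y) = normal_pdf (- m) s y.
Proof.
move=> s0; rewrite (normal_pdfE m s0) (normal_pdfE (- m) s0) /normal_fun.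
by rewrite -opprD sqrrN opprK.
Qed.

Lemma is_derive_normal_pdf m s y : s != 0 ->
  is_derive y 1 (normal_pdf m s) (- ((y - m) / s ^+ 2 * normal_pdf m s y)).
Proof.
move=> s0; rewrite (normal_pdfE m s0) /normal_fun.
apply: is_derive_eq.
by rewrite /GRing.scale /=; field; rewrite s0.
Qed.

(** The Radon-Nikodym derivative of the law and the explicit density have the same integral over
    every measurable set, hence agree almost everywhere. *)
Lemma integral_normal_prob m s (f : R -> R) : s != 0 -> (forall y, 0 <= f y) ->
    measurable_fun [set: R] f ->
  (\int[normal_prob m s]_y (f y)%:E = \int[mu]_y (f y * normal_pdf m s y)%:E)%E.
Proof.
move=> s0 f0 mf.
have dom := normal_prob_dominates m s.
have mfE : measurable_fun [set: R] (EFin \o f) by exact/measurable_EFinP.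
rewrite -(@Radon_Nikodym_SigmaFinite.change_of_variables _ _ _ (normal_prob m
  s) mu dom) //.
apply: ae_eq_integral => //.
- apply: emeasurable_funM => //; apply: measurable_int.
  exact: Radon_Nikodym_SigmaFinite.f_integrable.
- apply/measurable_EFinP/measurable_funM => //; exact: measurable_normal_pdf.
- under [X in ae_eq _ _ _ X]eq_fun do rewrite EFinM.
  apply: ae_eqe_mul2l; apply: integral_ae_eq => //.
  + exact: Radon_Nikodym_SigmaFinite.f_integrable.
  + by apply/measurable_EFinP; exact: measurable_normal_pdf.
  + by move=> E _ mE; rewrite -Radon_Nikodym_SigmaFinite.f_integral.
Qed.

End NormalDensity.

(** * Integration over half-lines and decay of the density at infinity *)

Section NormalIntegrals.
Context {R : realType}.
Implicit Types (a m s y z : R) (f F : R -> R).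
Local Notation mu := (@lebesgue_measure R).

Lemma derivable_continuous f f' : (forall y, is_derive y 1 f (f' y)) ->
  continuous f.
Proof.
by move=> df y; apply/differentiable_continuous/derivable1_diffP; case: (df y).
Qed.

Lemma ge0_FTC2y f F a l : (forall y, a <= y -> 0 <= f y) -> continuous f ->
    (forall y, is_derive y 1 F (f y)) -> F y @[y --> +oo] --> l ->
  (\int[mu]_(y in `[a, +oo[) (f y)%:E = (l - F a)%:E)%E.
Proof.
move=> f0 cf dF Fl; have cF := derivable_continuous dF.
rewrite (@ge0_continuous_FTC2y _ f F a l) //.
- exact: continuous_subspaceT.
- by apply: cvg_at_right_filter; exact: cF.
- by move=> y _; rewrite derive1E; case: (dF y).
Qed.

(** Half of the exponential absorbs the linear factor: [1 + z / 2 <= expR (z / 2)] bounds the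
    product by [2 * expR (- (z / 2))]. *)
Lemma cvgr_mul_expRN : z * expR (- z) @[z --> +oo] --> (0 : R).
Proof.
have e2 : 2 * expR (- (z / 2)) @[z --> +oo] --> (0 : R).
  rewrite -(mulr0 2); apply: cvgMl_tmp.
  apply: (@cvg_comp _ _ _ (fun z : R => z / 2) (fun z => expR (- z)) _
    (pinfty_nbhs R)).
    exact: gt0_cvgMly.
  exact: cvgr_expR.
apply: (@squeeze_cvgr _ _ _ _ (cst 0) (fun z => 2 * expR (- (z / 2)))) => //.
  near=> z.
  have z0 : 0 <= z by near: z; apply: nbhs_pinfty_ge; exact: num_real.
  rewrite /cst mulr_ge0 ?expR_ge0 //=.
  have -> : - z = - (z / 2) + - (z / 2) by field.
  rewrite expRD mulrA ler_pM2r ?expR_gt0 //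
    expRN -ler_pdivlMr ?invr_gt0 ?expR_gt0 // invrK.
  have := expR_ge1Dx (z / 2); lra.
exact: cvg_cst.
Unshelve. all: by end_near. Qed.

Lemma normal_pdf_expE m s y : s != 0 ->
  normal_pdf m s y = normal_peak s * expR (- ((y - m) ^+ 2 / (s ^+ 2 * 2))).
Proof.
by move=> s0; rewrite (normal_pdfE m s0) /normal_fun mulNr mulr_natr.
Qed.

Lemma cvgy_normal_exponent m s : s != 0 ->
  (y - m) ^+ 2 / (s ^+ 2 * 2) @[y --> +oo] --> +oo.
Proof.
move=> s0; apply: gt0_cvgMly.
  by rewrite invr_gt0 mulr_gt0 // exprn_even_gt0.
apply: (@ger_cvgy _ _ _ _ (fun y => y - m)).
  (* Past [m + 1] the square of [y - m] dominates [y - m] itself. *)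
  near=> y; have : m + 1 <= y by near: y; apply: nbhs_pinfty_ge;
    exact: num_real.
  by move=> ?; nra.
exact: cvg_addrr.
Unshelve. all: by end_near. Qed.

Lemma cvgy_normal_pdf m s : s != 0 -> normal_pdf m s y @[y --> +oo] --> 0.
Proof.
move=> s0.
have /funext -> : normal_pdf m s =1 fun y =>
    normal_peak s * expR (- ((y - m) ^+ 2 / (s ^+ 2 * 2))).
  by move=> y; exact: normal_pdf_expE.
rewrite -(mulr0 (normal_peak s)); apply: cvgMl_tmp.
apply: (cvg_comp _ (fun z => expR (- z)) (cvgy_normal_exponent m s0)).
exact: cvgr_expR.
Qed.

(** For [1 <= y] the factor [y] is at most [y ^+ 2], and [y ^+ 2] times the density is a constant
    times [u * expR (- u)], where [- u] is the exponent of the density. *)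
Lemma cvgy_mul_normal_pdf s : s != 0 -> y * normal_pdf 0 s y @[y --> +oo] --> 0.
Proof.
move=> s0.
pose u y := (y - 0) ^+ 2 / (s ^+ 2 * 2).
have cu : (normal_peak s * (s ^+ 2 * 2)) * (u y * expR (- u y))
    @[y --> +oo] --> 0.
  rewrite -(mulr0 (normal_peak s * (s ^+ 2 * 2))); apply: cvgMl_tmp.
  apply: (cvg_comp u (fun z => z * expR (- z)) (cvgy_normal_exponent 0 s0)).
  exact: cvgr_mul_expRN.
apply: squeeze_cvgr cu; last exact: cvg_cst.
near=> y.
have y1 : 1 <= y by near: y; apply: nbhs_pinfty_ge; exact: num_real.
have p0 : 0 <= normal_pdf 0 s y by exact: normal_pdf_ge0.
rewrite mulr_ge0 //=.
have -> : normal_peak s * (s ^+ 2 * 2) * (u y * expR (- u y)) =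
    y ^+ 2 * normal_pdf 0 s y.
  rewrite normal_pdf_expE // -/(u y) /u subr0; field.
  by rewrite s0.
by rewrite ler_wpM2r //; nra.
Unshelve. all: by end_near. Qed.

(** The integrand is the derivative of [- s ^+ 2] times the density, and [m <= a] makes it
    nonnegative. *)
Lemma integral_sub_mul_normal_pdf m s a : s != 0 -> m <= a ->
  (\int[mu]_(y in `[a, +oo[) ((y - m) * normal_pdf m s y)%:E =
   (s ^+ 2 * normal_pdf m s a)%:E)%E.
Proof.
move=> s0 ma.
have -> : s ^+ 2 * normal_pdf m s a = 0 - (- s ^+ 2 * normal_pdf m s a).
  by rewrite sub0r mulNr opprK.
apply: (@ge0_FTC2y _ (fun y => - s ^+ 2 * normal_pdf m s y) a 0).
- move=> y ay; rewrite mulr_ge0 ?normal_pdf_ge0 //; lra.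
- move=> y; apply: cvgM; last exact: continuous_normal_pdf.
  by apply: cvgB; [exact: cvg_id | exact: cvg_cst].
- move=> y; have dp := is_derive_normal_pdf m y s0.
  apply: is_derive_eq; rewrite /GRing.scale /=; field; by rewrite s0.
- rewrite -(mulr0 (- s ^+ 2)); apply: cvgMl_tmp; exact: cvgy_normal_pdf.
Qed.

End NormalIntegrals.

(** * First moments and overshoot beyond a level *)

Section NormalMoments.
Context {R : realType}.
Implicit Types (a b c m s y z L : R) (f g : R -> R).
Local Notation mu := (@lebesgue_measure R).

Lemma continuous_EFin_measurable f : continuous f ->
  measurable_fun [set: R] (EFin \o f).
Proof. by move=> cf; apply/measurable_EFinP;
  exact: continuous_measurable_fun. Qed.

Lemma continuous_mul_normal_pdf f m s : s != 0 -> continuous f ->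
  continuous (fun y => f y * normal_pdf m s y).
Proof. by move=> s0 cf y; apply: cvgM;
  [exact: cf | exact: continuous_normal_pdf]. Qed.

Lemma continuous_subr a : continuous (fun y => y - a).
Proof. by move=> y; apply: cvgB; [exact: cvg_id | exact: cvg_cst]. Qed.

Lemma continuous_max0 f : continuous f -> continuous (fun y => Num.max (f y) 0).
Proof. by move=> cf y; apply: continuous_max; [exact: cf | exact: cvg_cst]. Qed.

Lemma ge0_integral_oppr f : continuous f -> (forall y, 0 <= f y) ->
  (\int[mu]_y (f (- y))%:E = \int[mu]_y (f y)%:E)%E.
Proof.
move=> cf f0; have mf := continuous_EFin_measurable cf.
have := @ge0_integral_pushforward _ _ _ _ _ (-%R : measurableTypeR R ->
  measurableTypeR R)
  (@oppr_measurable R setT) mu setT (EFin \o f) measurableT mf.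
rewrite preimage_setT => <-; last by move=> y _; rewrite lee_fin.
apply: eq_measure_integral => A mA _; exact: lebesgue_measureN.
Qed.

Lemma integral_max_sub g a :
  (\int[mu]_y (Num.max (y - a) 0 * g y)%:E =
    \int[mu]_(y in `[a, +oo[) ((y - a) * g y)%:E)%E.
Proof.
rewrite [RHS]integral_mkcond; apply: eq_integral => y _;
  rewrite patchE mem_setE in_itv /= andbT.
case: leP => ay; first by rewrite max_l ?subr_ge0.
by rewrite max_r ?mul0r // subr_le0 ltW.
Qed.

Lemma integral_pos_part_normal m s : s != 0 ->
  (\int[mu]_y (Num.max (y - m) 0 * normal_pdf m s y)%:E =
      (s ^+ 2 * normal_pdf m s m)%:E)%E.
Proof. by move=> s0; rewrite integral_max_sub integral_sub_mul_normal_pdf. Qed.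

Lemma integral_neg_part_normal m s : s != 0 ->
  (\int[mu]_y (Num.max (m - y) 0 * normal_pdf m s y)%:E =
      (s ^+ 2 * normal_pdf m s m)%:E)%E.
Proof.
move=> s0; rewrite -ge0_integral_oppr; last 2 first.
- apply: continuous_mul_normal_pdf => //; apply: continuous_max0 => y.
  by apply: cvgB; [exact: cvg_cst | exact: cvg_id].
- by move=> y; rewrite mulr_ge0 ?normal_pdf_ge0 // le_max lexx orbT.
have -> : s ^+ 2 * normal_pdf m s m = s ^+ 2 * normal_pdf (- m) s (- m).
  by rewrite normal_pdfN // opprK.
rewrite -(integral_pos_part_normal (- m) s0); apply: eq_integral => y _.
by rewrite normal_pdfN // !opprK addrC.
Qed.

(** Since [0 <= L], at most one of [y - L] and [- y - L] is positive, so the overshoot of [|y|] is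
    the sum of their positive parts; by reflection both contribute the same integral. *)
Lemma integral_overshoot_normal s L : s != 0 -> 0 <= L ->
  (\int[mu]_y (Num.max (`|y| - L) 0 * normal_pdf 0 s y)%:E =
   2%:E * \int[mu]_(y in `[L, +oo[) ((y - L) * normal_pdf 0 s y)%:E)%E.
Proof.
move=> s0 L0; pose f y := Num.max (y - L) 0 * normal_pdf 0 s y.
have f0 y : 0 <= f y by rewrite mulr_ge0 ?normal_pdf_ge0 // le_max lexx orbT.
have cf : continuous f.
  by apply: continuous_mul_normal_pdf => //; apply: continuous_max0;
    exact: continuous_subr.
have cfN : continuous (f \o -%R).
  by move=> y; apply: continuous_comp; [exact: opp_continuous | exact: cf].
transitivity (\int[mu]_y ((f y)%:E + ((f \o -%R) y)%:E))%E.
  apply: eq_integral => y _; rewrite -EFinD /f /= normal_pdfN // oppr0 -mulrDl.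
  congr (_ * _)%:E; have [y0|y0] := leP 0 y.
    by rewrite ger0_norm // (@max_r _ _ (- y - L)) ?addr0 //; lra.
  by rewrite ltr0_norm // (@max_r _ _ (y - L)) ?add0r //; lra.
rewrite ge0_integralD //; last 4 first.
- by move=> y _; rewrite lee_fin.
- exact: continuous_EFin_measurable.
- by move=> y _; rewrite lee_fin /=.
- exact: continuous_EFin_measurable.
by rewrite /= ge0_integral_oppr // integral_max_sub mule_natl mule2n.
Qed.

Lemma integral_norm_normal s : s != 0 ->
  (\int[mu]_y (`|y| * normal_pdf 0 s y)%:E =
      (2 * (s ^+ 2 * normal_pdf 0 s 0))%:E)%E.
Proof.
move=> s0; rewrite EFinM -(integral_sub_mul_normal_pdf s0 (lexx 0))
  -integral_overshoot_normal //.
by apply: eq_integral => y _; rewrite subr0 max_l.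
Qed.

End NormalMoments.

(** * The variance of the centred normal law *)

Section NormalSecondMoment.
Context {R : realType}.
Implicit Types (a b c m s y z L : R) (f g : R -> R).
Local Notation mu := (@lebesgue_measure R).

Lemma FTC2_is_derive f F a b : a < b -> continuous f ->
    (forall y, is_derive y 1 F (f y)) ->
  (\int[mu]_(y in `[a, b]) (f y)%:E = (F b - F a)%:E)%E.
Proof.
move=> ab cf dF; have cF := derivable_continuous dF.
rewrite (@continuous_FTC2 _ f F a b) //.
- exact: continuous_subspaceT.
- split => //.
  + by apply: cvg_at_right_filter; exact: cF.
  + by apply: cvg_at_left_filter; exact: cF.
- by move=> y _; rewrite derive1E; case: (dF y).
Qed.

Lemma ge0_integral_split f a b : continuous f -> (forall y, 0 <= f y) -> a <=
  b ->
  (\int[mu]_(y in `[a, +oo[) (f y)%:E =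
   \int[mu]_(y in `[a, b]) (f y)%:E + \int[mu]_(y in `[b, +oo[) (f y)%:E)%E.
Proof.
move=> cf f0 ab; have mf := continuous_EFin_measurable cf.
rewrite (@itv_bndbnd_setU _ _ _ (BLeft b)) ?bnd_simp //.
rewrite ge0_integral_setU //.
- by rewrite integral_itv_bndo_bndc //; exact: measurable_funTS.
- exact: measurable_funTS.
- by move=> y _; rewrite lee_fin.
- apply/disj_setPS => y /= []; rewrite !in_itv /= andbT => /andP[_ yb] by_.
  by move: (lt_le_trans yb by_); rewrite ltxx.
Qed.

Lemma ge0_integral_continuousD D f g : measurable D ->
    continuous f -> continuous g ->
    (forall y, D y -> 0 <= f y) -> (forall y, D y -> 0 <= g y) ->
  (\int[mu]_(y in D) (f y + g y)%:E = \int[mu]_(y in D) (f y)%:E +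
    \int[mu]_(y in D) (g y)%:E)%E.
Proof.
move=> mD cf cg f0 g0; rewrite -ge0_integralD //.
- by apply: measurable_funTS; exact: continuous_EFin_measurable.
- by apply: measurable_funTS; exact: continuous_EFin_measurable.
Qed.

Lemma ge0_integral_continuousZl D c f : measurable D -> 0 <= c ->
    continuous f -> (forall y, D y -> 0 <= f y) ->
  (\int[mu]_(y in D) (c * f y)%:E = c%:E * \int[mu]_(y in D) (f y)%:E)%E.
Proof.
move=> mD c0 cf f0; rewrite -ge0_integralZl_EFin //.
by apply: measurable_funTS; exact: continuous_EFin_measurable.
Qed.

Lemma is_derive_mul_normal_pdf s y : s != 0 ->
  is_derive y 1 (fun y => - s ^+ 2 * (y * normal_pdf 0 s y))
    ((y ^+ 2 - s ^+ 2) * normal_pdf 0 s y).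
Proof.
move=> s0; have dp := is_derive_normal_pdf 0 y s0.
apply: is_derive_eq; rewrite /GRing.scale /=; field; by rewrite s0.
Qed.

Lemma continuous_sqr_cst c d : continuous (fun y => c * y ^+ 2 + d).
Proof.
move=> y; apply: cvgD; last exact: cvg_cst.
by apply: cvgMl_tmp; exact: sqr_continuous.
Qed.

(* [(y ^+ 2 - s ^+ 2) * normal_pdf 0 s y] is the derivative of
   [- s ^+ 2 * (y * normal_pdf 0 s y)] and changes sign at [s]: splitting there
   leaves only nonnegative integrands and no subtraction in [\bar R]. *)
Lemma integral_sqr_normal_pos s : 0 < s ->
  (\int[mu]_y (y ^+ 2 * normal_pdf 0 s y)%:E = (s ^+ 2)%:E)%E.
Proof.
move=> s_gt0; have s0 : s != 0 by rewrite gt_eqF.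
have p_ge0 y : 0 <= normal_pdf 0 s y by exact: normal_pdf_ge0.
have cpdf c d : continuous (fun y => (c * y ^+ 2 + d) * normal_pdf 0 s y).
  by apply: continuous_mul_normal_pdf => //; exact: continuous_sqr_cst.
have csqr : continuous (fun y => y ^+ 2 * normal_pdf 0 s y).
  by apply: continuous_mul_normal_pdf => //; exact: sqr_continuous.
have cp := @continuous_normal_pdf _ 0 s s0.
have tot : (\int[mu]_(y in `[0%R, +oo[) (normal_pdf 0 s y)%:E = (2^-1)%:E)%E.
  have := integral_normal_pdf 0 s; rewrite ge0_symfun_integralT //; last first.
    by move=> y; rewrite /= normal_pdfN // oppr0.
  rewrite -set_itvcy => /(congr1 (fun x => (2^-1)%:E * x)%E).
  by rewrite muleA -EFinM mulVf // mul1e mule1.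
rewrite ge0_symfun_integralT //; last 2 first.
- by move=> y; rewrite mulr_ge0 ?sqr_ge0.
- by move=> y; rewrite /= sqrrN normal_pdfN // oppr0.
rewrite -set_itvcy (@ge0_integral_split _ _ s) ?ltW //; last first.
  by move=> y; rewrite mulr_ge0 ?sqr_ge0.
(* The boundary term at [s] stands on the left here and on the right in [high]. Substituting [high]
   therefore produces exactly the left side of [low], and the term disappears without being
   subtracted. *)
have low : (\int[mu]_(y in `[0%R, s]) (y ^+ 2 * normal_pdf 0 s y)%:E
    + (s ^+ 2 * (s * normal_pdf 0 s s))%:E
    = (s ^+ 2)%:E * \int[mu]_(y in `[0%R, s]) (normal_pdf 0 s y)%:E)%E.
  pose F y := s ^+ 2 * (y * normal_pdf 0 s y).
  have dF y : is_derive y 1 F ((-1 * y ^+ 2 + s ^+ 2) * normal_pdf 0 s y).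
    have dp := is_derive_normal_pdf 0 y s0.
    by apply: is_derive_eq; rewrite /GRing.scale /=; field; rewrite s0.
  have := FTC2_is_derive s_gt0 (cpdf _ _) dF.
  rewrite {2}/F mul0r mulr0 subr0 => <-.
  rewrite -ge0_integral_continuousD //; first last.
  - move=> y; rewrite /= in_itv /= => /andP[y0 ys]; apply: mulr_ge0 => //; nra.
  - by move=> y _; rewrite mulr_ge0 ?sqr_ge0.
  rewrite -ge0_integral_continuousZl ?sqr_ge0 //.
  by apply: eq_integral => y _; congr (_%:E); ring.
have high : (\int[mu]_(y in `[s, +oo[) (y ^+ 2 * normal_pdf 0 s y)%:E
    = (s ^+ 2 * (s * normal_pdf 0 s s))%:E
    + (s ^+ 2)%:E * \int[mu]_(y in `[s, +oo[) (normal_pdf 0 s y)%:E)%E.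
  pose F y := - s ^+ 2 * (y * normal_pdf 0 s y).
  have dF y : is_derive y 1 F ((1 * y ^+ 2 + - s ^+ 2) * normal_pdf 0 s y).
    by rewrite mul1r; exact: is_derive_mul_normal_pdf.
  have F0 : F y @[y --> +oo] --> 0.
    by rewrite -(mulr0 (- s ^+ 2)); apply: cvgMl_tmp;
      exact: cvgy_mul_normal_pdf.
  have f0 y : s <= y -> 0 <= (1 * y ^+ 2 + - s ^+ 2) * normal_pdf 0 s y.
    by move=> sy; apply: mulr_ge0 => //; nra.
  have := ge0_FTC2y f0 (cpdf _ _) dF F0.
  rewrite sub0r /F mulNr opprK => <-.
  rewrite -ge0_integral_continuousZl ?sqr_ge0 //.
  rewrite -ge0_integral_continuousD //.
  - by apply: eq_integral => y _; congr (_%:E); ring.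
  - by move=> y; apply: cvgMl_tmp; exact: cp.
  - by move=> y; rewrite /= in_itv /= andbT => sy; apply: mulr_ge0 => //; nra.
  - by move=> y _; rewrite mulr_ge0 ?sqr_ge0.
rewrite high addeA low -ge0_muleDr ?integral_ge0 //; last 2 first.
- by move=> y _; rewrite lee_fin.
- by move=> y _; rewrite lee_fin.
rewrite -ge0_integral_split ?ltW // tot -!EFinM; congr (_%:E); by field.
Qed.

End NormalSecondMoment.

(** * Upper and lower bounds for the tail integral *)

Section NormalTail.
Context {R : realType}.
Implicit Types (c s y L : R) (f g : R -> R).
Local Notation mu := (@lebesgue_measure R).

Lemma continuous_mul_expR c L : continuous (fun y => (y - L) * expR (- (c * (y
  - L)))).
Proof.
move=> y; apply: cvgM; first exact: continuous_subr.
apply: (@cvg_comp _ _ _ (fun y => - (c * (y - L))) expR);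
  last exact: continuous_expR.
by apply: cvgN; apply: cvgMl_tmp; exact: continuous_subr.
Qed.

(** This is the gamma integral of order 2; the antiderivative [F] comes from one integration by
    parts. *)
Lemma integral_gamma2 c L : 0 < c ->
  (\int[mu]_(y in `[L, +oo[) ((y - L) * expR (- (c * (y - L))))%:E =
    (c ^- 2)%:E)%E.
Proof.
move=> c0; have c1 : c != 0 by rewrite gt_eqF.
pose F y := - ((y - L) / c + c ^- 2) * expR (- (c * (y - L))).
have dF y : is_derive y 1 F ((y - L) * expR (- (c * (y - L)))).
  by apply: is_derive_eq; rewrite /GRing.scale /=; field; rewrite c1.
have cz : c * (y - L) @[y --> +oo] --> +oo.
  by apply: gt0_cvgMry => //; exact: cvg_addrr.
have F0 : F y @[y --> +oo] --> 0.
  have -> : F = fun y => - c ^- 2 * ((c * (y - L)) * expR (- (c * (y - L))) +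
    expR (- (c * (y - L)))).
    by apply/funext => y; rewrite /F; field; rewrite c1.
  rewrite -(mulr0 (- c ^- 2)) -[X in _ * X](addr0 0); apply: cvgMl_tmp;
    apply: cvgD.
    exact: (cvg_comp _ (fun z => z * expR (- z)) cz (@cvgr_mul_expRN R)).
  exact: (cvg_comp _ (fun z => expR (- z)) cz (@cvgr_expR R)).
have f0 y : L <= y -> 0 <= (y - L) * expR (- (c * (y - L))).
  by move=> Ly; rewrite mulr_ge0 ?expR_ge0 ?subr_ge0.
have cf := @continuous_mul_expR c L.
have := ge0_FTC2y f0 cf dF F0.
by rewrite sub0r /F subrr mul0r add0r mulr0 oppr0 expR0 mulr1 opprK.
Qed.

(** The exponent of the density is concave in [y], hence lies below its tangent at [L]; the gap is
    [(y - L) ^+ 2 / (s ^+ 2 * 2)]. *)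
Lemma normal_pdf_le_expR s L y : s != 0 ->
  normal_pdf 0 s y <= normal_pdf 0 s L * expR (- (L / s ^+ 2 * (y - L))).
Proof.
move=> s0; rewrite !normal_pdf_expE //
  -(mulrA (normal_peak s)) ler_pM2l ?normal_peak_gt0 //.
rewrite -expRD ler_expR -subr_ge0.
have -> : - ((L - 0) ^+ 2 / (s ^+ 2 * 2)) + - (L / s ^+ 2 * (y - L))
    - - ((y - 0) ^+ 2 / (s ^+ 2 * 2))
    = (y - L) ^+ 2 / (s ^+ 2 * 2) by field; rewrite s0.
by rewrite divr_ge0 ?sqr_ge0 // mulr_ge0 ?sqr_ge0.
Qed.

Lemma normal_tail_le s L : s != 0 -> 0 < L ->
  (\int[mu]_(y in `[L, +oo[) ((y - L) * normal_pdf 0 s y)%:E <=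
   (s ^+ 4 / L ^+ 2 * normal_pdf 0 s L)%:E)%E.
Proof.
move=> s0 L0; pose c := L / s ^+ 2.
have c0 : 0 < c by rewrite divr_gt0 // exprn_even_gt0.
have cg := @continuous_mul_expR c L.
have -> : s ^+ 4 / L ^+ 2 * normal_pdf 0 s L = normal_pdf 0 s L * c ^- 2.
  by rewrite /c; field; rewrite s0 gt_eqF.
rewrite EFinM -(integral_gamma2 L c0) -ge0_integral_continuousZl
  ?normal_pdf_ge0 //; last first.
  by move=> y; rewrite /= in_itv /= andbT => Ly;
    rewrite mulr_ge0 ?expR_ge0 ?subr_ge0.
apply: ge0_le_integral => //.
- by move=> y; rewrite /= in_itv /= andbT => Ly;
    rewrite lee_fin mulr_ge0 ?normal_pdf_ge0 ?subr_ge0.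
- apply: measurable_funTS; apply: continuous_EFin_measurable.
  by apply: continuous_mul_normal_pdf => //; exact: continuous_subr.
- apply: measurable_funTS; apply: continuous_EFin_measurable.
  by move=> y; apply: cvgMl_tmp; exact: cg.
- move=> y; rewrite /= in_itv /= andbT => Ly;
    rewrite lee_fin mulrCA ler_wpM2l ?subr_ge0 //.
  exact: normal_pdf_le_expR.
Qed.

(** Only positivity of the left side matters: it makes the error strictly positive. From [L + 1] on,
    [y - L] is at least [y / (L + 1)], and [y] times the density has an explicit antiderivative. *)
Lemma normal_tail_ge s L : s != 0 -> 0 < L ->
  ((s ^+ 2 * normal_pdf 0 s (L + 1) / (L + 1))%:E <=
   \int[mu]_(y in `[L, +oo[) ((y - L) * normal_pdf 0 s y)%:E)%E.
Proof.
move=> s0 L0.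
have cf a : continuous (fun y => (y - a) * normal_pdf 0 s y).
  by apply: continuous_mul_normal_pdf => //; exact: continuous_subr.
have L1 : 0 <= L + 1 by lra.
apply: (@le_trans _ _ (\int[mu]_(y in `[(L +
  1)%R, +oo[) ((y - L) * normal_pdf 0 s y)%:E)%E); last first.
  apply: ge0_subset_integral => //.
  - by apply: measurable_funTS; exact: continuous_EFin_measurable.
  - by move=> y; rewrite /= in_itv /= andbT => Ly;
      rewrite lee_fin mulr_ge0 ?normal_pdf_ge0 ?subr_ge0.
  - by move=> y; rewrite /= !in_itv /= !andbT; lra.
rewrite mulrC EFinM -(integral_sub_mul_normal_pdf s0 L1)
  -ge0_integral_continuousZl ?invr_ge0 //; last first.
  by move=> y; rewrite /= in_itv /= andbT => Ly;
    rewrite mulr_ge0 ?normal_pdf_ge0 ?subr_ge0 //; lra.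
apply: ge0_le_integral => //.
- move=> y; rewrite /= in_itv /= andbT => Ly;
    rewrite lee_fin !mulr_ge0 ?normal_pdf_ge0 ?invr_ge0 //; lra.
- apply: measurable_funTS; apply: continuous_EFin_measurable.
  by move=> y; apply: cvgMl_tmp; exact: cf.
- by apply: measurable_funTS; exact: continuous_EFin_measurable.
- move=> y; rewrite /= in_itv /= andbT => Ly;
    rewrite lee_fin mulrA ler_wpM2r ?normal_pdf_ge0 //.
  rewrite mulrC ler_pdivrMr; [nra | lra].
Qed.

Lemma normal_tail s L : s != 0 -> 0 < L -> exists2 e : R,
  (\int[mu]_(y in `[L, +oo[) ((y - L) * normal_pdf 0 s y)%:E = e%:E)%E &
  0 < e <= s ^+ 4 / L ^+ 2 * normal_pdf 0 s L.
Proof.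
move=> s0 L0; have := normal_tail_le s0 L0; have := normal_tail_ge s0 L0.
(* Real bounds on both sides rule out the two infinite values. *)
case: (\int[mu]_(y in _) _)%E => [e| |] //; rewrite !lee_fin => lb ub.
exists e => //; rewrite ub andbT; apply: lt_le_trans lb.
apply: divr_gt0; last lra.
by apply: mulr_gt0; [rewrite exprn_even_gt0 | exact: normal_pdf_gt0].
Qed.

End NormalTail.

(** * Random variables with a normal law *)

Section NormalLaw.
Context {d : measure_display} {T : measurableType d} {R : realType}.
Variables (P : probability T R) (X : T -> R).
Hypothesis mX : measurable_fun [set: T] X.
Implicit Types (m s L : R) (f : R -> R).
Local Notation mu := (@lebesgue_measure R).

Definition normal_law m s := forall B, measurable B -> P (X @^-1` B) =
  normal_prob m s B.

Lemma integral_normal_law m s f : s != 0 -> normal_law m s ->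
    (forall y, 0 <= f y) -> continuous f ->
  (\int[P]_w (f (X w))%:E = \int[mu]_y (f y * normal_pdf m s y)%:E)%E.
Proof.
move=> s0 Xlaw f0 cf; rewrite -integral_normal_prob //;
  last exact: continuous_measurable_fun.
pose Y : {mfun T >-> measurableTypeR R} := HB.pack (X : T ->
  measurableTypeR R) (@isMeasurableFun.Build _ _ T (measurableTypeR R) X mX).
transitivity (\int[distribution P Y]_y (f y)%:E)%E; last first.
  by apply: eq_measure_integral => B mB _; exact: Xlaw.
rewrite ge0_integral_distribution //; first exact: continuous_EFin_measurable.
Qed.

Lemma integrable_ge0 (U : T -> R) c : measurable_fun [set: T] U ->
  (forall w, 0 <= U w) -> (\int[P]_w (U w)%:E = c%:E)%E ->
  P.-integrable [set: T] (EFin \o U).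
Proof.
move=> mU U0 intU; apply/integrableP; split; first exact/measurable_EFinP.
under eq_integral do rewrite /= ger0_norm //.
by rewrite intU ltry.
Qed.

(** [X] is [m] plus the difference of its positive and negative parts about [m], whose integrals are
    finite and equal. Together with the zero-mean hypothesis this identifies the parameter [m] of
    the law. *)
Lemma expectation_normal_law m s : s != 0 -> normal_law m s -> ('E_P[X] =
  m%:E)%E.
Proof.
move=> s0 Xlaw; rewrite unlock.
have cU : continuous (fun y => Num.max (y - m) 0) by apply: continuous_max0;
  exact: continuous_subr.
have cV : continuous (fun y => Num.max (m - y) 0).
  by apply: continuous_max0 => y; apply: cvgB; [exact: cvg_cst | exact: cvg_id].
pose U w := Num.max (X w - m) 0; pose V w := Num.max (m - X w) 0.
have iU : (\int[P]_w (U w)%:E = (s ^+ 2 * normal_pdf m s m)%:E)%E.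
  rewrite -(integral_pos_part_normal m s0); apply: integral_normal_law cU => //.
  by move=> y; rewrite le_max lexx orbT.
have iV : (\int[P]_w (V w)%:E = (s ^+ 2 * normal_pdf m s m)%:E)%E.
  rewrite -(integral_neg_part_normal m s0); apply: integral_normal_law cV => //.
  by move=> y; rewrite le_max lexx orbT.
have mU : measurable_fun [set: T] U.
  exact: (measurableT_comp (continuous_measurable_fun cU) mX).
have mV : measurable_fun [set: T] V.
  exact: (measurableT_comp (continuous_measurable_fun cV) mX).
have U0 w : 0 <= U w by rewrite le_max lexx orbT.
have V0 w : 0 <= V w by rewrite le_max lexx orbT.
have intU := integrable_ge0 mU U0 iU; have intV := integrable_ge0 mV V0 iV.
have intm : P.-integrable [set: T] (cst m%:E).
  exact: finite_measure_integrable_cst.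
transitivity (\int[P]_w (((EFin \o U) \- (EFin \o V)) w + m%:E))%E.
  apply: eq_integral => w _; rewrite /= -EFinB -EFinD /U /V; congr _%:E.
  have [Xm|Xm] := leP (X w) m.
    by rewrite max_r ?max_l //; lra.
  by rewrite max_l ?max_r //; lra.
rewrite integralD //; last exact: integrableB.
rewrite integralB // iU iV subee // add0e integral_cst //.
by rewrite [X in (_ * X)%E](_ : _ = 1%E) ?mule1 //; exact: probability_setT.
Qed.

End NormalLaw.

(** * Heat loss from an interval as a truncated absolute moment *)

Section Tonelli.
Context {d : measure_display} {T : measurableType d} {R : realType}.
Variables (P : probability T R) (X : T -> R).
Hypothesis mX : measurable_fun [set: T] X.
Implicit Types a b L : R.
Local Notation mu := (@lebesgue_measure R).

(** Tonelli is applied to the indicator of the pairs [(x, w)] for which both [x] and [x + X w] lie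
    in the interval. For fixed [w] the admissible [x] form the intersection of the interval with its
    translate by [- X w], of length [b - a - |X w|] or 0. *)
Lemma integral_prob_shift_itv a b : a < b ->
  (\int[mu]_(x in `]a, b[) P [set w | `]a, b[%classic (x + X w)%R]
   = \int[P]_w (Num.max (b - a - `|X w|) 0)%:E)%E.
Proof.
move=> ab.
pose A := [set z : measurableTypeR R * T | a < z.1 < b /\ a < z.1 + X z.2 < b].
have mA : measurable A.
  rewrite (_ : A = (fst @^-1` `]a, b[%classic) `&` ((fun z => z.1 +
    X z.2) @^-1` `]a, b[%classic)) //.
  apply: measurableI.
    by rewrite -[X in measurable X]setTI; apply: measurable_fst.
  rewrite -[X in measurable X]setTI.
  have : measurable_fun [set: measurableTypeR R * T] (fun z => z.1 + X z.2).
    apply: measurable_funD; first exact: measurable_fst.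
    by apply: (measurableT_comp mX); exact: measurable_snd.
  by apply.
have := @indic_fubini_tonelli _ _ _ _ R mu P A mA.
rewrite indic_fubini_tonelli_FE // indic_fubini_tonelli_GE // => FG.
rewrite [LHS]integral_mkcond.
transitivity (\int[mu]_x (P \o xsection A) x)%E.
  apply: eq_integral => x _; rewrite patchE /=; case: ifPn => xD.
    congr (P _); apply/seteqP; split => w /=; rewrite /xsection /= inE /A /=.
      by split => //; move: xD; rewrite inE.
    by case.
  rewrite (_ : xsection A x = set0) ?measure0 //.
  apply/seteqP; split => w //=; rewrite /xsection /= inE => -[/= xab _].
  by move: xD; rewrite notin_setE.
rewrite FG; apply: eq_integral => w _ /=.
rewrite (_ : ysection A w =
  `]Num.max a (a - X w), Num.min b (b - X w)[%classic).
  rewrite lebesgue_measure_itv /= lte_fin.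
  have [X0|X0] := leP 0 (X w).
    have -> : Num.max a (a - X w) = a by rewrite max_l; lra.
    have -> : Num.min b (b - X w) = b - X w by rewrite min_r; lra.
    rewrite ger0_norm //; case: ltP => h; rewrite -?EFinD; congr _%:E.
      by rewrite max_l; lra.
    by rewrite max_r; lra.
  have -> : Num.max a (a - X w) = a - X w by rewrite max_r; lra.
  have -> : Num.min b (b - X w) = b by rewrite min_l; lra.
  rewrite ltr0_norm //; case: ltP => h; rewrite -?EFinD; congr _%:E.
    by rewrite max_l; lra.
  by rewrite max_r; lra.
apply/seteqP; split => x; rewrite /ysection /= inE /A /= !in_itv /=
  gt_max lt_min.
  by move=> [/andP[-> ->] /andP[]]; rewrite ltrBlDr ltrBrDr => -> ->.
by move=> /andP[/andP[-> +] /andP[-> +]]; rewrite ltrBlDr ltrBrDr => -> ->.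
Qed.

Let measurable_continuous_comp (f : R -> R) : continuous f ->
  measurable_fun [set: T] (EFin \o (f \o X)).
Proof.
move=> cf; apply/measurable_EFinP.
exact: (measurableT_comp (continuous_measurable_fun cf) mX).
Qed.

Let continuous_min_norm L : continuous (fun y : R => Num.min `|y| L).
Proof. by move=> y; apply: continuous_min;
  [exact: norm_continuous | exact: cvg_cst]. Qed.

Let continuous_max_norm L : continuous (fun y : R => Num.max (`|y| - L) 0).
Proof.
apply: continuous_max0 => y; apply: cvgB;
  [exact: norm_continuous | exact: cvg_cst].
Qed.

Let continuous_max_Nnorm L : continuous (fun y : R => Num.max (L - `|y|) 0).
Proof.
apply: continuous_max0 => y; apply: cvgB;
  [exact: cvg_cst | exact: norm_continuous].
Qed.

Lemma integral_min_norm L : 0 <= L ->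
  (\int[P]_w (Num.min `|X w| L)%:E + \int[P]_w (Num.max (L - `|X w|) 0)%:E =
    L%:E)%E.
Proof.
move=> L0; rewrite -ge0_integralD //; last 4 first.
- by move=> w _; rewrite lee_fin le_min normr_ge0.
- exact: (measurable_continuous_comp (@continuous_min_norm L)).
- by move=> w _; rewrite lee_fin le_max lexx orbT.
- exact: (measurable_continuous_comp (@continuous_max_Nnorm L)).
transitivity (\int[P]_w (cst L%:E w))%E.
  apply: eq_integral => w _; rewrite -EFinD; congr _%:E.
  by have [h|h] := leP `|X w| L; [rewrite max_l | rewrite max_r]; lra.
rewrite integral_cst //.
by rewrite [X in (_ * X)%E](_ : _ = 1%E) ?mule1 //; exact: probability_setT.
Qed.

(** Combined with [integral_min_norm], this eliminates the truncated moment and ties the heat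
    content to the absolute moment and the overshoot. *)
Lemma integral_min_overshoot L : 0 <= L ->
  (\int[P]_w (Num.min `|X w| L)%:E + \int[P]_w (Num.max (`|X w| - L) 0)%:E
   = \int[P]_w `|X w|%:E)%E.
Proof.
move=> L0; rewrite -ge0_integralD //; last 4 first.
- by move=> w _; rewrite lee_fin le_min normr_ge0.
- exact: (measurable_continuous_comp (@continuous_min_norm L)).
- by move=> w _; rewrite lee_fin le_max lexx orbT.
- exact: (measurable_continuous_comp (@continuous_max_norm L)).
apply: eq_integral => w _; rewrite -EFinD; congr _%:E.
by have [h|h] := leP `|X w| L; [rewrite max_r | rewrite max_l]; lra.
Qed.

End Tonelli.

(** * Gaussian processes with cadlag paths *)

Section Interval.
Context {R : realType}.

(** The interior of a bounded interval is the open interval between its infimum and supremum, and an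
    open [D] is its own interior. *)
Lemma open_bounded_interval (D : set R) : D !=set0 -> bounded_set D -> open D ->
  is_interval D -> exists a b : R, a < b /\ D = `]a, b[%classic.
Proof.
move=> [x Dx] /pinfty_ex_gt0[M M0 DM] oD iD.
have lD : has_lbound D.
  by exists (- M) => y /DM /=; rewrite ler_norml => /andP[].
have uD : has_ubound D.
  by exists M => y /DM /=; rewrite ler_norml => /andP[].
have DE := interval_bounded_interior iD lD uD.
rewrite (proj1 (interior_id D) oD) in DE.
exists (inf D), (sup D); split.
  by move: Dx; rewrite {1}DE /= => /andP[]; exact: lt_trans.
by rewrite {1}DE; apply/seteqP; split => y /=; rewrite in_itv.
Qed.

End Interval.

(** * Right neighbourhoods of time 0 *)

Section FromRight0.
Context {R : realType}.
Implicit Types (t : I01 R) (A : set (I01 R)).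

Lemma I01_ge0 t : 0 <= val t.
Proof. by case: t => x /= /set_mem; rewrite /I01 /= in_itv /= => /andP[]. Qed.

Lemma from_right0P A : from_right (time0 R) A <->
  exists2 e : R, 0 < e & forall t, 0 < val t < e -> A t.
Proof.
have ballE e t : ball (time0 R) e t <-> val t < e.
  rewrite /ball /= /initial_ball set_valE /ball /= sub0r normrN ger0_norm //;
    exact: I01_ge0.
split.
  move=> /nbhs_ballP[e /= e0 h]; exists e => // t /andP[t0 te].
  by apply: h => //; apply/ballE.
move=> [e e0 h]; apply/nbhs_ballP; exists e => //= t /ballE te t0.
by apply: h; rewrite te andbT.
Qed.

Lemma cvg_from_right0 (u : (I01 R)^nat) : (forall n, 0 < val (u n) <
  n.+1%:R^-1) ->
  u n @[n --> \oo] --> from_right (time0 R).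
Proof.
move=> hu A /from_right0P[e e0 h].
suff : \forall n \near \oo, A (u n) by [].
near=> n; apply: h; have /andP[-> un] /= := hu n.
apply: lt_trans un _; near: n; exact: (near_infty_natSinv_lt (PosNum e0)).
Unshelve. all: by end_near. Qed.

End FromRight0.

Section Coordinate.
Context {R : realType}.
Variable P : probability (skorokhod R) R.
Local Notation X := (@coordinate R).

Lemma measurable_coordinate t : measurable_fun [set: skorokhod R] (X t).
Proof.
move=> _ B mB; apply: sub_sigma_algebra; exists t => //.
by exists B.
Qed.

Lemma gaussian_coordinate (t : I01 R) : gaussian_process P X ->
    ('E_P[X t] = 0)%E -> (0 < P [set w | X t w <> 0%R])%E ->
  exists2 s : R, 0 < s & normal_law P (X t) 0 s.
Proof.
move=> gX EX0 ndX; have mX := measurable_coordinate t.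
have [m [s law]] := gX 1%N (fun=> t) (fun=> 1).
have {}law B : measurable B -> P (X t @^-1` B) = gaussian_law m s B.
  move=> mB; rewrite -law //; congr (P _); apply/seteqP.
  by split => w /=; rewrite big_ord_recl big_ord0 mul1r addr0.
have [s0|s0] := eqVneq s 0; last first.
  have lawN : normal_law P (X t) m s.
    by move=> B mB; rewrite law // /gaussian_law (negbTE s0).
  have := expectation_normal_law mX s0 lawN; rewrite EX0 => -[m0].
  exists `|s|; first by rewrite normr_gt0.
  by move=> B mB; rewrite (lawN B mB) /normal_prob -m0 normal_pdf_norm.
(* Degenerate case: the law is a point mass at [m], the zero mean forces [m = 0], and this
   contradicts non-degeneracy. *)
have {}law B : measurable B -> P (X t @^-1` B) = (\d_m B)%E.
  by move=> mB; rewrite law // /gaussian_law s0 eqxx.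
have m0 : m = 0.
  suff : (m%:E = 0 :> \bar R)%E by case.
  rewrite -EX0 unlock; transitivity (\int[P]_w (cst m%:E w))%E.
    rewrite integral_cst //.
    by rewrite [X in (_ * X)%E](_ : _ = 1%E) ?mule1 //; exact: probability_setT.
  apply: ae_eq_integral => //; first exact/measurable_EFinP.
  exists (X t @^-1` (~` [set m])); split.
  - by rewrite -[A in measurable A]setTI; apply: mX => //; exact: measurableC.
  - apply: (etrans (law _ _)); first exact: measurableC.
    by rewrite /dirac indicE memNset //= => /(_ erefl).
  - by move=> w /= nXm Xm; apply: nXm => _; rewrite /= Xm.
move: ndX; rewrite (_ : [set w | _] = X t @^-1` (~` [set 0%R])) //.
rewrite law ?m0; last exact: measurableC.
by rewrite /dirac indicE memNset ?ltxx //= => /(_ erefl).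
Qed.

Lemma variance_normal (t : I01 R) (s : R) : 0 < s -> normal_law P (X t) 0 s ->
  variance_function P t = s ^+ 2.
Proof.
move=> s_gt0 law; have s0 : s != 0 by rewrite gt_eqF.
rewrite /variance_function unlock.
have := integral_normal_law (measurable_coordinate t) s0 law (fun y => sqr_ge0
  y) (@sqr_continuous R).
by rewrite integral_sqr_normal_pos // => ->.
Qed.

End Coordinate.

(** * Expansion of the heat content at a fixed time *)

Section HeatContentNormal.
Context {R : realType}.

Lemma normal_peakE (s : R) : 0 < s -> normal_peak s =
  (s * Num.sqrt (2 * pi))^-1.
Proof.
move=> s0; rewrite /normal_peak; congr (_^-1).
have -> : s ^+ 2 * pi *+ 2 = s ^+ 2 * (2 * pi) by rewrite -mulr_natr; ring.
by rewrite sqrtrM ?sqr_ge0 // sqrtr_sqr gtr0_norm.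
Qed.

Lemma mul_sqrtr_2pi : Num.sqrt (2 / pi) * Num.sqrt (2 * pi) = 2 :> R.
Proof.
move: pi (pi_gt0 R) => p p0.
rewrite -sqrtrM; last by rewrite divr_ge0 ?(ltW p0).
have -> : 2 / p * (2 * p) = 2 ^+ 2 by field; rewrite gt_eqF.
by rewrite sqrtr_sqr ger0_norm.
Qed.

(** This makes the peak of the density at most [1 / (2 * s)], so a ball of radius [r], of length
    [2 * r], has mass at most [r / s]. *)
Lemma sqrtr_2pi_ge2 : 2 <= Num.sqrt (2 * pi) :> R.
Proof.
rewrite -[leLHS](@ger0_norm _ 2) // -sqrtr_sqr ler_wsqrtr //.
have := @pi_ge2 R; nra.
Qed.

Lemma heat_content_normal (P : probability (skorokhod R) R) (a b s : R) (t :
  I01 R) :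
    a < b -> 0 < s -> normal_law P (@coordinate R t) 0 s ->
  let L := b - a in
  exists2 e : R, L - heat_content P `]a, b[%classic t =
    s * Num.sqrt (2 / pi) - e &
    0 < e <= 2 * s ^+ 3 / (L ^+ 2 * Num.sqrt (2 * pi))
        * expR (- (L ^+ 2 / (2 * s ^+ 2))).
Proof.
move=> ab s_gt0 law L; have s0 : s != 0 by rewrite gt_eqF.
have L0 : 0 < L by rewrite subr_gt0.
have mX := measurable_coordinate t.
have [e eE /andP[e0 eub]] := normal_tail s0 L0.
have H : heat_content P `]a, b[%classic t
    = fine (\int[P]_w (Num.max (L - `|coordinate t w|) 0)%:E)%E.
  by rewrite /heat_content -(integral_prob_shift_itv P mX ab).
have gH := integral_min_norm P mX (ltW L0).
have ge := integral_min_overshoot P mX (ltW L0).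
have normE : (\int[P]_w `|coordinate t w|%:E =
    (2 * (s ^+ 2 * normal_pdf 0 s 0))%:E)%E.
  rewrite -(integral_norm_normal s0).
  by apply: (integral_normal_law mX s0 law (fun y => normr_ge0 y));
    exact: norm_continuous.
have overE : (\int[P]_w (Num.max (`|coordinate t w| - L) 0)%:E = (2 * e)%:E)%E.
  rewrite EFinM -eE -integral_overshoot_normal ?ltW //.
  apply: (integral_normal_law mX s0 law (f := fun y => Num.max (`|y| - L) 0)).
    by move=> y; rewrite le_max lexx orbT.
  apply: continuous_max0 => y; apply: cvgB;
    [exact: norm_continuous | exact: cvg_cst].
move: gH ge; rewrite overE normE {}H.
(* Both identities have finite right-hand sides, so both integrals are real numbers [g] and [h]. *)
case: (\int[P]_w (Num.min _ _)%:E)%E => [g| |] //.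
case: (\int[P]_w (Num.max _ _)%:E)%E => [h| |] //.
rewrite -!EFinD => -[gh] -[ge] /=.
have sq0 : 0 < Num.sqrt (2 * pi) :> R by have := sqrtr_2pi_ge2; lra.
have pdf0 : s ^+ 2 * normal_pdf 0 s 0 = s * (Num.sqrt (2 * pi))^-1.
  rewrite normal_pdf_expE // subr0 expr0n /=
    mul0r oppr0 expR0 mulr1 normal_peakE //.
  by field; rewrite s0 gt_eqF.
have sq2 : Num.sqrt (2 / pi) = 2 / Num.sqrt (2 * pi) :> R.
  by apply: (mulIf (lt0r_neq0 sq0)); rewrite mul_sqrtr_2pi divfK // gt_eqF.
(* [e] is the one-sided tail; both signs of the coordinate contribute. *)
exists (2 * e).
  rewrite pdf0 in ge; rewrite sq2.
  have -> : s * (2 / Num.sqrt (2 * pi)) =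
    2 * (s * (Num.sqrt (2 * pi))^-1) by ring.
  lra.
apply/andP; split; first by rewrite mulr_gt0.
apply: (@le_trans _ _ (2 * (s ^+ 4 / L ^+ 2 * normal_pdf 0 s L)));
  first by rewrite ler_pM2l.
(* Once the peak is expanded the two sides are equal. *)
rewrite le_eqVlt; apply/orP; left; apply/eqP.
rewrite normal_pdf_expE // subr0 normal_peakE // (mulrC (s ^+ 2)).
by field; rewrite s0 !gt_eqF.
Qed.

End HeatContentNormal.

(** * Vanishing of the variance at time 0 *)

Section VarianceAt0.
Context {R : realType}.
Variable P : probability (skorokhod R) R.
Hypothesis start0 : P [set w | coordinate (time0 R) w = 0] = 1%E.
Local Notation X := (@coordinate R).
Local Notation mu := (@lebesgue_measure R).

Lemma normal_small_ball (t : I01 R) (s r : R) : 0 < s -> 0 <= r ->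
  normal_law P (X t) 0 s ->
  (P (X t @^-1` `[(- r)%R, r]) <= (r / s)%:E)%E.
Proof.
move=> s_gt0 r0 law; have s0 : s != 0 by rewrite gt_eqF.
rewrite law // /normal_prob.
apply: (@le_trans _ _ (\int[mu]_(y in `[(- r)%R, r]) (cst (normal_peak s)%:E
  y))%E).
  apply: ge0_le_integral => //.
  - by move=> y _; rewrite lee_fin normal_pdf_ge0.
  - by apply/measurable_EFinP/measurable_funTS; exact: measurable_normal_pdf.
  - by move=> y _; rewrite lee_fin; exact: normal_pdf_ub.
rewrite integral_cst //= lebesgue_measure_itv /= lte_fin.
case: ifPn => _; last by rewrite mule0 lee_fin divr_ge0 // ltW.
rewrite -EFinB -EFinM lee_fin normal_peakE // opprK invfM.
have sq0 : 0 < Num.sqrt (2 * pi) :> R by have := @sqrtr_2pi_ge2 R; lra.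
rewrite -mulrA mulrC ler_wpM2r ?invr_ge0 ?(ltW s_gt0) //.
rewrite mulrC ler_pdivrMr //; have := @sqrtr_2pi_ge2 R; nra.
Qed.

Lemma coordinate_small_ball_cvg1 (u : (I01 R)^nat) (r : R) : 0 < r ->
    (forall n, 0 < val (u n) < n.+1%:R^-1) ->
  P (X (u n) @^-1` `[(- r)%R, r]) @[n --> \oo] --> 1%E.
Proof.
move=> r0 hu.
pose E n := X (u n) @^-1` `[(- r)%R, r].
have mE n : measurable (E n).
  by rewrite -[A in measurable A]setTI; apply: measurable_coordinate.
have m0 : measurable [set w | X (time0 R) w = 0].
  by rewrite -[A in measurable A]setTI;
    exact: (@measurable_coordinate R (time0 R) measurableT _ (measurable_set1
    0)).
have := @dominated_convergence _ _ _ P [set: skorokhod R] measurableT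
  (fun n w => (\1_(E n) w)%:E) (cst 1%E) (cst 1%E).
case.
- by move=> n; apply/measurable_EFinP; exact: measurable_indic.
- exact: measurable_cst.
(* The exceptional null set consists of the paths not starting at 0. On any other path, right
   continuity at time 0 keeps the indicators eventually equal to 1. *)
- exists (~` [set w | X (time0 R) w = 0]); split; first exact: measurableC.
  + by have := probability_setC P m0; rewrite start0 subee.
  + move=> w /= nw w0; apply: nw => _ /=.
    have [+ _] := @path_cadlag R w (time0 R).
    move=> /(_ (@ltr01 R)) wr.
    have /cvgrPdist_le /(_ r r0) near_r := cvg_comp _ _ (cvg_from_right0 hu) wr.
    apply: cvg_near_cst; near=> n; rewrite indicE mem_set //.
    rewrite /E /= in_itv /= -ler_norml.
    have : `|X (time0 R) w - X (u n) w| <= r by near: n; exact: near_r.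
    by rewrite w0 sub0r normrN.
- exact: finite_measure_integrable_cst.
- by apply/aeW => w n _ /=; rewrite lee_fin indicE; case: (_ \in _);
    rewrite ?normr1 ?normr0.
move=> _ _; rewrite integral_cst //.
rewrite [A in (_ * A)%E](_ : _ = 1%E) ?mule1 //; last exact: probability_setT.
apply: cvg_trans; apply: near_eq_cvg; apply: nearW => n /=.
by rewrite integral_indic // setIT.
Unshelve. all: by end_near. Qed.

Lemma variance_cvg0 :
    (forall t, 0 < val t -> exists2 s : R, 0 < s & normal_law P (X t) 0 s) ->
  variance_function P t @[t --> from_right (time0 R)] --> 0.
Proof.
move=> law; apply/cvgrPdist_lt => /= e e0; apply: contrapT => nF.
(* Failure of the limit is turned into a sequence of times, the form that dominated convergence
   requires. *)
have /choice[u hu] n : exists t : I01 R, 0 < val t < n.+1%:R^-1 /\ e <=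
  variance_function P t.
  apply: contrapT => nt; apply/nF/from_right0P; exists n.+1%:R^-1;
    first by rewrite invr_gt0.
  move=> t tn; rewrite /= ltNge; apply/negP => et; apply: nt; exists t;
    split => //.
  have [s s_gt0 st] := law t (proj1 (andP tn)).
  by move: et; rewrite (variance_normal s_gt0 st) sub0r normrN ger0_norm
    ?sqr_ge0.
have hu1 n := proj1 (hu n).
have se0 : 0 < Num.sqrt e by rewrite sqrtr_gt0.
(* Along the sequence [s] is at least [Num.sqrt e]; half of that as radius caps the ball
   probabilities at 1/2, against their limit 1. *)
have h0 : 0 < Num.sqrt e / 2 by rewrite divr_gt0.
have := coordinate_small_ball_cvg1 h0 hu1.
set p := (fun n => _) => p1.
have pub n : (p n <= (2^-1)%:E)%E.
  have [s s_gt0 st] := law (u n) (proj1 (andP (hu1 n))).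
  apply: le_trans (normal_small_ball s_gt0 (ltW h0) st) _.
  have := proj2 (hu n); rewrite (variance_normal s_gt0 st) => es.
  have : Num.sqrt e <= s by rewrite -(ger0_norm (ltW s_gt0)) -sqrtr_sqr
    ler_wsqrtr.
  by rewrite lee_fin ler_pdivrMr //; lra.
have : (limn p <= (2^-1)%:E)%E.
  by apply: lime_le; [apply/cvg_ex; exists 1%E | apply: nearW].
rewrite (cvg_lim _ p1) // lee_fin; lra.
Qed.

End VarianceAt0.

Lemma sqr_powR3half (R : realType) (s : R) : 0 <= s -> (s ^+ 2) `^ (3 / 2) =
  s ^+ 3.
Proof.
move=> s0; rewrite -(powR_mulrn 2 s0) -powRrM -(powR_mulrn 3 s0).
by congr (_ `^ _); field.
Qed.

Unset Implicit Arguments.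

Theorem theorem3p2 (R : realType) (D : set R)
    (D_nonempty : D !=set0) (D_bounded : bounded_set D)
    (D_open : open D) (D_interval : is_interval D)
    (P : probability (skorokhod R) R)
    (X_start : P [set w | coordinate (time0 R) w = 0] = 1%E)
    (X_gaussian : gaussian_process P (@coordinate R))
    (X_mean : forall t : I01 R, ('E_P[coordinate t] = 0)%E)
    (X_nondegenerate : forall t : I01 R, 0 < val t ->
       (0 < P [set w | coordinate t w <> 0%R])%E) :
  (exists Err : I01 R -> R, forall t : I01 R, 0 < val t ->
     len D - heat_content P D t
       = Num.sqrt (2 * variance_function P t / pi) - Err t
     /\ 0 < Err t
     /\ Err t <= 2 * variance_function P t `^ (3 / 2)
                 / (len D ^+ 2 * Num.sqrt (2 * pi))
                 * expR (- (len D ^+ 2 / (2 * variance_function P t))))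
  /\ ((len D - heat_content P D t) / Num.sqrt (variance_function P t)
        @[t --> from_right (time0 R)] --> Num.sqrt (2 / pi)).
Proof.
have [a [b [ab DE]]] := open_bounded_interval D_nonempty D_bounded D_open
  D_interval.
have lenE : len D = b - a by rewrite /len DE lebesgue_measure_itv /= lte_fin ab.
have L0 : 0 < b - a by rewrite subr_gt0.
have law (t : I01 R) : 0 < val t ->
  exists2 s : R, 0 < s & normal_law P (coordinate t) 0 s.
  by move=> t0; exact: gaussian_coordinate (X_gaussian) (X_mean t)
    (X_nondegenerate t t0).
have expansion (t : I01 R) : 0 < val t -> exists s e : R, [/\ 0 < s,
    variance_function P t = s ^+ 2,
    len D - heat_content P D t = s * Num.sqrt (2 / pi) - e &
    0 < e <= 2 * s ^+ 3 / (len D ^+ 2 * Num.sqrt (2 * pi))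
             * expR (- (len D ^+ 2 / (2 * s ^+ 2)))].
  move=> t0; have [s s_gt0 st] := law t t0.
  have [e eE eb] := heat_content_normal ab s_gt0 st.
  exists s, e; split => //; first exact: variance_normal.
  - by rewrite lenE DE.
  - by rewrite lenE.
split.
  (* Defining the error as the discrepancy makes the expansion hold by construction; only the two
     bounds remain. *)
  exists (fun t => Num.sqrt (2 * variance_function P t / pi)
                   - (len D - heat_content P D t)) => t t0.
  have [s [e [s_gt0 VE HE /andP[e0 eub]]]] := expansion t t0.
  have sqE : Num.sqrt (2 * variance_function P t / pi) = s * Num.sqrt (2 / pi).
    by rewrite VE -mulrA mulrCA sqrtrM ?sqr_ge0 // sqrtr_sqr gtr0_norm.
  by rewrite /= HE sqE VE sqr_powR3half ?(ltW s_gt0) // !subKr.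
have sq0 : 0 < Num.sqrt (2 * pi) :> R by have := @sqrtr_2pi_ge2 R; lra.
(* With the exponential bounded by 1, the error divided by [s] is at most [C * s ^+ 2], a multiple
   of the variance. *)
pose C := 2 / (len D ^+ 2 * Num.sqrt (2 * pi)).
have C0 : 0 <= C by rewrite divr_ge0 // mulr_ge0 ?sqr_ge0 // ltW.
have cvgV : C * variance_function P t @[t --> from_right (time0 R)] --> 0.
  by rewrite -(mulr0 C); apply: cvgMl_tmp; exact: variance_cvg0.
apply/cvgrPdist_le => /= eps eps0.
move/cvgrPdist_le : cvgV => /(_ eps eps0) /= /from_right0P[r r0 hr].
apply/from_right0P; exists r => // t tr /=.
have /andP[t0 _] := tr.
have := hr t tr.
have [s [e [s_gt0 VE HE /andP[e0 eub]]]] := expansion t t0.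
have s0 : s != 0 by rewrite gt_eqF.
rewrite VE HE sqrtr_sqr (gtr0_norm s_gt0) sub0r normrN.
rewrite ger0_norm; last exact: mulr_ge0 C0 (sqr_ge0 s).
apply: le_trans.
have -> : Num.sqrt (2 / pi) - (s * Num.sqrt (2 / pi) - e) / s = e / s.
  by field.
rewrite ger0_norm; last by rewrite divr_ge0 // ltW.
rewrite ler_pdivrMr //; apply: le_trans eub _.
have CE : C * s ^+ 2 * s = 2 * s ^+ 3 / (len D ^+ 2 * Num.sqrt (2 * pi)).
  by rewrite /C; ring.
rewrite -CE ler_piMr //; first exact: mulr_ge0 (mulr_ge0 C0 (sqr_ge0 s)) (ltW
  s_gt0).
rewrite -[leRHS]expR0 ler_expR oppr_le0; apply: divr_ge0; first exact: sqr_ge0.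
by apply: mulr_ge0; last exact: sqr_ge0.
Qed.
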